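(* For every integer $n\geq 10$ there exists a maximum 8-cycle packing of $K_n$ which is not almost 2-perfect.
   Context: An 8-cycle packing of $K_n$ on an $n$-element vertex set $\mathcal{X}$ is a triple $(\mathcal{X},\mathcal{C},\mathcal{L})$ where $\mathcal{C}$ is a collection of pairwise edge-disjoint 8-cycles of $K_n$ and the leave $\mathcal{L}$ is the set of edges of $K_n$ lying in no cycle of $\mathcal{C}$. It is a maximum packing if $|\mathcal{L}|$ is as small as possible among all 8-cycle packings of $K_n$. For an 8-cycle $C$, an inside 8-cycle of $C$ is an 8-cycle on the same vertex set as $C$ sharing no edge with $C$. The packing is almost 2-perfect (A2P) if one can choose, for each $C\in\mathcal{C}$, an inside 8-cycle $C'$ of $C$ such that the chosen cycles $\mathcal{C}'$ are pairwise edge-disjoint and contain no edge of $\mathcal{L}$, i.e. $(\mathcal{X},\mathcal{C}',\mathcal{L})$ is again an 8-cycle packing with the same leave. *)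

(* Defs.v *)
From mathcomp Require Import all_boot.
Set Implicit Arguments. Unset Strict Implicit. Unset Printing Implicit Defensive.

(* K_n on vertex set 'I_n; an edge is a 2-element subset of 'I_n.
   An 8-cycle is represented by its edge set. *)
Definition edge (n : nat) := {set 'I_n}.

Definition is_8cycle (n : nat) (E : {set {set 'I_n}}) : Prop :=
  exists t : 8.-tuple 'I_n,
    uniq t /\ E = [set [set tnth t i; tnth t (ordS i)] | i : 'I_8].

Definition cycle_vertices (n : nat) (E : {set {set 'I_n}}) : {set 'I_n} :=
  cover E.

Definition packing8 (n : nat) (C : {set {set {set 'I_n}}}) : Prop :=
  (forall E, E \in C -> is_8cycle E) /\
  (forall E1 E2, E1 \in C -> E2 \in C -> E1 != E2 -> [disjoint E1 & E2]).

Definition leave (n : nat) (C : {set {set {set 'I_n}}}) : {set {set 'I_n}} :=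
  [set e : {set 'I_n} | (#|e| == 2) && (e \notin cover C)].

Definition max_packing8 (n : nat) (C : {set {set {set 'I_n}}}) : Prop :=
  packing8 C /\
  (forall C' : {set {set {set 'I_n}}}, packing8 C' -> #|leave C| <= #|leave C'|).

Definition inside8 (n : nat) (E E' : {set {set 'I_n}}) : Prop :=
  is_8cycle E' /\ cycle_vertices E' = cycle_vertices E /\ [disjoint E & E'].

Definition A2P (n : nat) (C : {set {set {set 'I_n}}}) : Prop :=
  exists f : {set {set 'I_n}} -> {set {set 'I_n}},
    (forall E, E \in C -> inside8 E (f E)) /\
    (forall E1 E2, E1 \in C -> E2 \in C -> E1 != E2 -> [disjoint f E1 & f E2]) /\
    (forall E, E \in C -> [disjoint f E & leave C]).

(* Main.v *)
Require Import Defs.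
From mathcomp Require Import all_boot.
From mathcomp Require Import zify.
Set Implicit Arguments. Unset Strict Implicit. Unset Printing Implicit Defensive.

(* Inside cycles witnessing that a packing is almost 2-perfect are as many as
   the cycles of the packing, are edge-disjoint and avoid the leave, so by
   counting they cover every edge outside the leave. Hence a packing is not
   almost 2-perfect as soon as some covered edge {u, v} is such that u and v lie
   together on no other cycle than the one containing {u, v}.

   Maximum packings with such an edge {0, 7} are given explicitly for
   12 <= n < 28. For larger n they come from those on n - 16 vertices: add a
   packing of the complete graph on the 16 new vertices (together with the old
   vertex 0 if n is odd) and decompose the remaining complete bipartite graph
   into copies of K_(4,4) and K_(6,4). This does not change how far the leave is
   from the lower bound, and no new cycle contains both 0 and 7.

   For n = 10 there are too few cycles for such an edge. There, and for n = 11,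
   an exhaustive search shows that inside cycles cannot be chosen. *)

(* With k cycles the leave has C(n, 2) - 8 k edges. Its degrees have the parity
   of n - 1, so it has at least n / 2 edges if n is even, and it does not have
   exactly 1 or 2 edges if n is odd. Modulo 8 its size is determined by n. *)
Definition enough_cycles (n k : nat) : bool :=
  if odd n then ('C(n, 2) <= 8 * k + 10) && ('C(n, 2) != 8 * k + 8)
  else 'C(n, 2) < 8 * k + n./2 + 8.

(** * Edge counts, vertex degrees and lower bounds on the leave *)

Section CyclesAndPackings.

Variable n : nat.
Implicit Types (x : 'I_n) (e : {set 'I_n}) (E : {set {set 'I_n}}).
Implicit Types C : {set {set {set 'I_n}}}.

Lemma set2_eqP (T : finType) (a b c d : T) :
  [set a; b] = [set c; d] -> (a = c /\ b = d) \/ (a = d /\ b = c).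
Proof.
move=> eq_abcd.
have /set2P ha : a \in [set c; d] by rewrite -eq_abcd set21.
have /set2P hb : b \in [set c; d] by rewrite -eq_abcd set22.
have /set2P hc : c \in [set a; b] by rewrite eq_abcd set21.
have /set2P hd : d \in [set a; b] by rewrite eq_abcd set22.
by case: ha => ha; case: hb => hb; [left | left | right | right]; split=> //;
   case: hc => hc; case: hd => hd; congruence.
Qed.

Lemma ordS_neq (i : 'I_8) : ordS i != i.
Proof. by case: i => -[|[|[|[|[|[|[|[|]]]]]]]] //. Qed.

Lemma ordS2_neq (i : 'I_8) : ordS (ordS i) != i.
Proof. by case: i => -[|[|[|[|[|[|[|[|]]]]]]]] //. Qed.

(** Two edges with different indices could only agree with their ends swapped. Each index would then
    be the successor of the other, which is impossible modulo 8. *)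
Lemma cycle_edge_inj (t : 8.-tuple 'I_n) : uniq t ->
  injective (fun i : 'I_8 => [set tnth t i; tnth t (ordS i)]).
Proof.
move=> /tuple_uniqP t_inj i j /set2_eqP[[/t_inj //]|[/t_inj ij /t_inj ji]].
by have := ordS2_neq i; rewrite ji ij eqxx.
Qed.

Lemma card_8cycle E : is_8cycle E -> #|E| = 8.
Proof.
by case=> t [Ut ->]; rewrite card_imset ?cardsT ?card_ord //; apply: cycle_edge_inj.
Qed.

Lemma card_8cycle_edge E e : is_8cycle E -> e \in E -> #|e| = 2.
Proof.
case=> t [/tuple_uniqP t_inj ->] /imsetP[i _ ->].
by rewrite cards2 (inj_eq t_inj) eq_sym ordS_neq.
Qed.

Lemma even_degree_8cycle E x : is_8cycle E -> ~~ odd (\sum_(e in E) (x \in e)).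
Proof.
case=> t [Ut ->]; rewrite big_imset /=; last by move=> i j _ _; apply: cycle_edge_inj.
have t_inj := tuple_uniqP _ Ut.
have [/tnthP[k ->]|xNt] := boolP (x \in t); last first.
  rewrite big1 // => i _; case: set2P => // xi.
  by case: xi xNt => ->; rewrite mem_tnth.
(* The vertex with index [k] lies on the edge leaving it and on the edge arriving from its
   predecessor, and on no other. *)
rewrite (eq_bigr (fun i => (i == k) + (i == ord_pred k))); last first.
  move=> i _; rewrite in_set2 !(inj_eq t_inj) -[in k == ordS i](ord_predK k).
  rewrite (inj_eq (can_inj (@ordSK _))) ![_ == i]eq_sym.
  have : k != ord_pred k by have := ordS_neq (ord_pred k); rewrite ord_predK.
  by case: (eqVneq i k) => [->|_]; [move/negbTE-> | case: eqVneq].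
by rewrite big_split /= -!big_mkcond /= !big_pred1_eq.
Qed.

Lemma packing8_trivIset C : packing8 C -> trivIset C.
Proof. by case=> _ dC; apply/trivIsetP => E1 E2; apply: dC. Qed.

Lemma card_cover_packing8 C : packing8 C -> #|cover C| = 8 * #|C|.
Proof.
move=> pC; have /eqP <- := packing8_trivIset pC.
rewrite (eq_bigr (fun=> 8)) => [|E EC]; first by rewrite sum_nat_const mulnC.
by apply: card_8cycle; case: pC => + _; apply.
Qed.

Lemma card_covered_edge C e : packing8 C -> e \in cover C -> #|e| = 2.
Proof. by case=> cC _ /bigcupP[E /cC cE]; apply: card_8cycle_edge. Qed.

Lemma card_leave C : packing8 C -> #|leave C| + 8 * #|C| = 'C(n, 2).
Proof.
move=> pC; rewrite -card_cover_packing8 //.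
have <- : #|[set e : {set 'I_n} | #|e| == 2]| = 'C(n, 2).
  by rewrite card_draws card_ord.
rewrite -[RHS](cardsID (cover C)) addnC; congr (_ + _); apply: eq_card => e.
  by rewrite !inE andbC; apply/esym/andb_idr => /card_covered_edge->.
by rewrite !inE andbC.
Qed.

(** The degree of [x] in the complete graph: an edge at [x] is determined by its other end. *)
Lemma card_star x : \sum_(e : {set 'I_n} | #|e| == 2) (x \in e) = n.-1.
Proof.
have <- : #|[set~ x]| = n.-1 by rewrite cardsC1 card_ord.
rewrite -big_mkcondr /= sum1_card.
rewrite -(card_in_imset (f := fun y => [set x; y])).
  apply: eq_card => e; rewrite [LHS]unfold_in /=.
  apply/andP/imsetP => [[/cards2P[a [b [ab ->]]]]|].
    case/set2P => ->; first by exists b; rewrite // !inE eq_sym.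
    by exists a; [rewrite !inE | rewrite setUC].
  by case=> y; rewrite !inE => yx ->; rewrite cards2 [x == y]eq_sym yx set21.
by move=> y z; rewrite !inE => yx _ /set2_eqP[[]|[]] // xz yx'; rewrite yx' eqxx in yx.
Qed.

(** The cycles through [x] remove an even number of edges from the [n - 1] edges at [x]. *)
Lemma odd_leave_degree C x : packing8 C ->
  odd (\sum_(e in leave C) (x \in e)) = odd n.-1.
Proof.
move=> pC; rewrite -(card_star x) [in RHS](bigID [in cover C]) /= oddD.
rewrite [X in odd X (+) _](eq_bigl [in cover C]) => [|e]; last first.
  by rewrite andbC; apply: andb_idr => /(card_covered_edge pC)->.
rewrite (big_trivIset _ (packing8_trivIset pC)) /=.
have -> : odd (\sum_(E in C) \sum_(e in E) (x \in e)) = false.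
  apply: (big_ind (fun k => odd k = false)) => // [a b|E EC].
    by rewrite oddD => -> ->.
  by apply/negbTE/even_degree_8cycle; case: pC => + _; apply.
by rewrite addFb; congr odd; apply: eq_bigl => e; rewrite inE.
Qed.

(** All degrees in the leave are odd, so its edges cover every vertex, and each edge covers only
    two. *)
Lemma leave_lower_bound_even C : packing8 C -> 0 < n -> ~~ odd n ->
  n <= 2 * #|leave C|.
Proof.
move=> pC n_gt0 nN.
have : #|cover (leave C)| <= 2 * #|leave C|.
  apply: leq_trans (leq_card_cover _) _.
  rewrite (eq_bigr (fun=> 2)); first by rewrite sum_nat_const mulnC.
  by move=> e; rewrite inE => /andP[/eqP].
apply: leq_trans; rewrite -[n in n <= _]card_ord -[#|'I_n|]cardsT subset_leq_card //.
apply/subsetP => x _; apply/bigcupP.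
have : odd (\sum_(e in leave C) (x \in e)).
  by rewrite odd_leave_degree // -subn1 oddB // (negbTE nN).
have [e /andP[eL xe] _|none] := pickP (fun e => (e \in leave C) && (x \in e)).
  by exists e.
by rewrite big1 // => e eL; have := none e; rewrite eL /= => ->.
Qed.

(** Degrees in the leave are even here, so an edge [e] of the leave is accompanied by a second leave
    edge at each of its two ends. These two differ, since an edge containing both ends is [e]
    itself. *)
Lemma leave_lower_bound_odd C : packing8 C -> odd n ->
  leave C != set0 -> 3 <= #|leave C|.
Proof.
move=> pC nO /set0Pn[e eL].
have other x : x \in e -> exists2 e', e' \in leave C :\ e & x \in e'.
  move=> xe; have : odd (\sum_(e in leave C) (x \in e)) = false.
    by rewrite odd_leave_degree //; case: (n) nO => //= m /negbTE.
  rewrite (big_setD1 e) //= xe.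
  have [e' /andP[]|none] := pickP (fun e' => (e' \in leave C :\ e) && (x \in e')).
    by exists e'.
  by rewrite big1 // => e' eL'; have := none e'; rewrite eL' /= => ->.
have := eL; rewrite inE => /andP[/cards2P[a [b [ab de]]] _].
have [|ea /setD1P[eae eaL] aea] := other a; first by rewrite de set21.
have [|eb /setD1P[ebe ebL] beb] := other b; first by rewrite de set22.
have ea_eb : ea != eb.
  apply: contraNneq eae => eab; rewrite eq_sym de eqEcard.
  rewrite subUset !sub1set aea eab beb cards2 ab /= -eab.
  by move: eaL; rewrite inE => /andP[/eqP->].
rewrite (cardsD1 e) eL (cardsD1 ea) (cardsD1 eb) !in_setD1 eae eaL ebe ebL.
by rewrite [eb == ea]eq_sym ea_eb.
Qed.

(** Sizes of leaves agree modulo 8, so a smaller leave has at least 8 edges fewer. The bound in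
    [enough_cycles] pushes it below what parity of degrees allows. *)
Lemma enough_cycles_max C : 0 < n ->
  packing8 C -> enough_cycles n #|C| -> max_packing8 C.
Proof.
move=> n_gt0 pC kC; split=> // C' pC'.
have cC := card_leave pC; have cC' := card_leave pC'.
move: kC; rewrite /enough_cycles; case: ifPn => [nO /andP[le10 ne8]|nE lt_half].
  (* If the leave of [C'] is empty, the leave of [C] has a multiple of 8 edges, at most 10 and not
     8, so it is empty too. *)
  have [L0|LN] := eqVneq (leave C') set0.
    by rewrite L0 cards0 in cC' *; lia.
  have := leave_lower_bound_odd pC' nO LN; lia.
have := leave_lower_bound_even pC' n_gt0 nE; lia.
Qed.

(* Disjointness makes the inside cycles cover as many edges as the packing
   itself, and all these edges lie outside the leave. *)
Lemma inside_cycles_cover C (f : {set {set 'I_n}} -> {set {set 'I_n}}) e :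
  packing8 C -> (forall E, E \in C -> inside8 E (f E)) ->
  (forall E1 E2, E1 \in C -> E2 \in C -> E1 != E2 -> [disjoint f E1 & f E2]) ->
  (forall E, E \in C -> [disjoint f E & leave C]) ->
  (e \in cover C) = (e \in cover (f @: C)).
Proof.
move=> pC inf djf lvf.
have cf E : E \in C -> is_8cycle (f E) by case/inf.
have pf : packing8 (f @: C).
  split=> [_ /imsetP[E EC ->]|_ _ /imsetP[E1 EC1 ->] /imsetP[E2 EC2 ->] ne12].
    exact: cf.
  by apply: djf => //; apply: contraNneq ne12 => ->.
(* Equal inside cycles for distinct cycles would be disjoint from themselves, hence empty. *)
have f_inj : {in C &, injective f}.
  move=> E1 E2 EC1 EC2 eqf; apply/eqP/negPn/negP => /djf-/(_ EC1 EC2).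
  rewrite eqf -setI_eq0 setIid -cards_eq0 card_8cycle //; exact: cf.
suff /eqP-> : cover (f @: C) == cover C by [].
rewrite eqEcard (card_cover_packing8 pC) (card_cover_packing8 pf).
rewrite card_in_imset // leqnn andbT.
apply/subsetP => e' /bigcupP[_ /imsetP[E EC ->] ef].
have := disjointFr (lvf _ EC) ef.
by rewrite inE (card_8cycle_edge (cf _ EC) ef) => /negbFE.
Qed.

(** The covered edge [[set x; y]] would also lie on the inside cycle of some [E]. Then [x] and [y]
    are vertices of [E], so the edge is in [E] as well, although a cycle and its inside cycle share
    no edge. *)
Lemma not_A2P_pair C x y : packing8 C -> [set x; y] \in cover C ->
  (forall E, E \in C -> x \in cover E -> y \in cover E -> [set x; y] \in E) ->
  ~ A2P C.
Proof.
move=> pC xyC bad [f [inf [djf lvf]]].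
have := xyC; rewrite (inside_cycles_cover _ pC inf djf lvf).
case/bigcupP=> _ /imsetP[E EC ->] xyf; have [_ [eqV djE]] := inf _ EC.
have inV z : z \in [set x; y] -> z \in cover E.
  by rewrite -[cover E]eqV => zxy; apply/bigcupP; exists [set x; y].
have := bad _ EC (inV _ (set21 _ _)) (inV _ (set22 _ _)).
by move=> /(disjointFr djE); rewrite xyf.
Qed.

End CyclesAndPackings.

(** * Cycles as lists of vertices, with computable edges *)

Definition norm_pair (p : nat * nat) := (minn p.1 p.2, maxn p.1 p.2).

(** Ordered pairs give each edge a single representation, so edges can be compared by computation.
    Rotating by one also supplies the closing edge. *)
Definition cycle_edges (c : seq nat) :=
  [seq norm_pair p | p <- zip c (rot 1 c)].

Definition packing_edges (L : seq (seq nat)) := flatten (map cycle_edges L).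

Definition cycle_on n (c : seq nat) :=
  [&& size c == 8, uniq c & all (fun x => x < n) c].

(** Edge-disjointness of all cycles is a single [uniq] test on the concatenated edges. *)
Definition list_packing n L := all (cycle_on n) L && uniq (packing_edges L).

Lemma uniq_flatten_map_inj (I T : eqType) (F : I -> seq T) s i j x :
  uniq (flatten (map F s)) -> i \in s -> j \in s -> x \in F i -> x \in F j ->
  i = j.
Proof.
elim: s => //= k s IHs; rewrite cat_uniq => /and3P[_ /hasPn dj /IHs IH].
have away l : l \in s -> x \in F l -> x \notin F k.
  by move=> ls xl; apply: dj; apply/flatten_mapP; exists l.
rewrite !inE => /orP[/eqP->|si] /orP[/eqP->|sj] // xi xj; last exact: IH.
- by have := away _ sj xj; rewrite xi.
- by have := away _ si xi; rewrite xj.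
Qed.

Lemma zip_rot (S T : Type) k (s : seq S) (t : seq T) :
  size s = size t -> zip (rot k s) (rot k t) = rot k (zip s t).
Proof.
move=> st; rewrite /rot zip_cat; last by rewrite !size_drop st.
congr (_ ++ _); first by elim: k s t st => [|k IHk] [|x s] [|y t] //= [/IHk].
by elim: k s t st => [|k IHk] [|x s] [|y t] //= [/IHk->].
Qed.

Lemma cycle_edges_rot k c : cycle_edges (rot k c) = rot k (cycle_edges c).
Proof. by rewrite /cycle_edges rot_rot zip_rot ?size_rot // map_rot. Qed.

Lemma size_cycle_edges c : size (cycle_edges c) = size c.
Proof. by rewrite size_map size_zip size_rot minnn. Qed.

Lemma cycle_edges_mem c p : p \in cycle_edges c -> p.1 \in c /\ p.2 \in c.
Proof.
case/mapP => q /(nthP (0, 0))[i]; rewrite size_zip size_rot minnn => ic.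
rewrite nth_zip ?size_rot //= => <- -> /=.
have x_c := mem_nth 0 ic; have y_c : nth 0 (rot 1 c) i \in c.
  by rewrite -(mem_rot 1) mem_nth // size_rot.
by rewrite /minn /maxn; case: ltnP.
Qed.

Lemma cycle_edges_lt c p : uniq c -> 1 < size c -> p \in cycle_edges c ->
  p.1 < p.2.
Proof.
move=> Uc c_gt1 /mapP[q /(nthP (0, 0))[i]].
rewrite size_zip size_rot minnn => ic; rewrite nth_zip ?size_rot //= => <- -> /=.
have minmax x y : x != y -> minn x y < maxn x y by lia.
apply: minmax.
rewrite /rot nth_cat size_drop.
case: c Uc c_gt1 ic => //= a c /andP[ac Uc] c_gt0 ic; rewrite drop0 take0 subSS subn0.
case: ltnP => [lt_ic|ge_ic].
  case: i ic lt_ic => [|i] ic lt_ic /=.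
    by apply: contraNneq ac => ->; apply: mem_nth.
  by rewrite nth_uniq //; lia.
(* The last index remains; the successor of the last vertex is the head [a]. *)
have -> : i = size c by lia.
rewrite subnn -(prednK c_gt0) /=; apply: contraNneq ac => <-.
by rewrite mem_nth // prednK.
Qed.

(** * From lists of numbers to sets of edges *)

Section Bridge.

Variable n : nat.
Implicit Types (c : seq nat) (L : seq (seq nat)) (p : nat * nat).

(** The vertex type is ['I_n.+1] because [inord] needs a nonempty target. Numbers above [n] would
    fall on the default vertex 0, hence the bounds in the lemmas below. *)
Definition pair_edge p : {set 'I_n.+1} := [set inord p.1; inord p.2].

Definition edge_set c : {set {set 'I_n.+1}} :=
  [set e in map pair_edge (cycle_edges c)].

Definition packing_set L : {set {set {set 'I_n.+1}}} :=
  [set E in map edge_set L].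

Lemma pair_edge_norm p : pair_edge (norm_pair p) = pair_edge p.
Proof.
case: p => x y; rewrite /pair_edge /norm_pair /minn /maxn /=.
by case: ltnP; rewrite // setUC.
Qed.

Lemma inord_inj x y : x <= n -> y <= n -> inord x = inord y :> 'I_n.+1 -> x = y.
Proof. by move=> xn yn /(congr1 val) /=; rewrite !inordK. Qed.

Lemma pair_edge_inj p q : p.1 < p.2 -> p.2 <= n -> q.1 < q.2 -> q.2 <= n ->
  pair_edge p = pair_edge q -> p = q.
Proof.
case: p q => [a b] [c d] /= ab bn cd dn.
case/set2_eqP => -[/inord_inj /= e1 /inord_inj /= e2].
  by congr (_, _); [apply: e1 | apply: e2]; lia.
have ad : a = d by apply: e1; lia.
have bc : b = c by apply: e2; lia.
by lia.
Qed.

Lemma cycle_on_edge c p : cycle_on n.+1 c -> p \in cycle_edges c ->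
  p.1 < p.2 /\ p.2 <= n.
Proof.
case/and3P => /eqP c8 Uc /allP cn pc; split.
  by apply: cycle_edges_lt pc; rewrite ?c8.
by have [_ /cn] := cycle_edges_mem pc.
Qed.

(** The cycle [d] certifies that [p] is an increasing pair of genuine vertices, where [pair_edge] is
    injective. *)
Lemma mem_edge_set c d p : cycle_on n.+1 c -> cycle_on n.+1 d ->
  p \in cycle_edges d -> (pair_edge p \in edge_set c) = (p \in cycle_edges c).
Proof.
move=> con don pd; rewrite inE; apply/mapP/idP => [[q qc]|pc]; last by exists p.
have [lt_p le_p] := cycle_on_edge don pd; have [lt_q le_q] := cycle_on_edge con qc.
by move/pair_edge_inj => ->.
Qed.

(** Both sides list the edges in the same order: [ordS] on indices is rotation by one on the
    list. *)
Lemma edge_set_tuple (t : 8.-tuple 'I_n.+1) :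
  [set [set tnth t i; tnth t (ordS i)] | i : 'I_8] = edge_set (map val t).
Proof.
apply/setP => e; rewrite inE.
have -> : map pair_edge (cycle_edges (map val t)) =
          [seq [set tnth t i; tnth t (ordS i)] | i <- enum 'I_8].
  rewrite -map_comp (eq_map (g := pair_edge)); last exact: pair_edge_norm.
  apply: (@eq_from_nth _ set0) => [|i].
    rewrite [RHS]size_map size_enum_ord [LHS]size_map size_zip size_rot size_map.
    by rewrite size_tuple.
  rewrite size_map size_zip size_rot size_map size_tuple minnn => i8.
  rewrite (nth_map (0, 0)) ?size_zip ?size_rot ?size_map ?size_tuple //.
  rewrite (nth_map ord0) ?size_enum_ord // nth_zip ?size_rot //.
  rewrite -[i in nth _ (enum _) i]/(val (Ordinal i8)) nth_ord_enum.
  rewrite /pair_edge /= -map_rot !(nth_map ord0) ?size_rot ?size_tuple //.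
  rewrite !inord_val !(tnth_nth ord0) /=; congr [set _; _].
  case: t i8 => -[|a0 [|a1 [|a2 [|a3 [|a4 [|a5 [|a6 [|a7 [|]]]]]]]]] //= _.
  by case: i => [|[|[|[|[|[|[|[|]]]]]]]].
apply/imsetP/mapP => -[i]; first by exists i; rewrite // mem_enum.
by exists i.
Qed.

Lemma edge_set_8cycle c : cycle_on n.+1 c -> is_8cycle (edge_set c).
Proof.
case/and3P => c8 Uc /allP cn.
have t8 : size (map (@inord n) c) == 8 by rewrite size_map.
have vK : map val (map (@inord n) c) = c.
  by rewrite -map_comp map_id_in // => x /cn xn /=; rewrite inordK.
exists (Tuple t8); rewrite edge_set_tuple /= vK; split=> //.
by apply: (map_uniq (f := val)); rewrite vK.
Qed.

Lemma cover_edge_set c : cycle_on n.+1 c ->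
  cover (edge_set c) = [set x : 'I_n.+1 | val x \in c].
Proof.
case/and3P => /eqP c8 Uc /allP cn; apply/setP => x; rewrite inE.
apply/bigcupP/idP => [[e]|xc].
  rewrite inE => /mapP[p /cycle_edges_mem[p1 p2] ->] /set2P[]->;
  by rewrite /= inordK ?cn.
(* The edge leaving [x] has the same index in [cycle_edges c] as [x] in [c]. *)
have : index (val x) c < size (cycle_edges c) by rewrite size_cycle_edges index_mem.
move=> ic; exists (pair_edge (nth (0, 0) (cycle_edges c) (index (val x) c))).
  by rewrite inE map_f // mem_nth.
have sz : index (val x) c < size (zip c (rot 1 c)).
  by move: ic; rewrite size_map.
rewrite (nth_map (0, 0)) // pair_edge_norm nth_zip ?size_rot //.
by rewrite /pair_edge /= nth_index // inord_val set21.
Qed.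

Section ListPacking.

Variable L : seq (seq nat).
Hypothesis pL : list_packing n.+1 L.

Lemma list_packing_on c : c \in L -> cycle_on n.+1 c.
Proof. by case/andP: pL => /allP + _; apply. Qed.

Lemma edge_set_shared c d e : c \in L -> d \in L ->
  e \in edge_set c -> e \in edge_set d -> c = d.
Proof.
move=> cL dL; rewrite inE => /mapP[p pc ->].
rewrite (mem_edge_set _ _ pc); try exact: list_packing_on.
by case/andP: pL => _ UL; apply: uniq_flatten_map_inj UL cL dL pc.
Qed.

Lemma packing_setP E :
  reflect (exists2 c, c \in L & E = edge_set c) (E \in packing_set L).
Proof. by rewrite inE; apply: mapP. Qed.

Lemma packing_set_packing8 : packing8 (packing_set L).
Proof.
split=> [_ /packing_setP[c cL ->]|].
  exact/edge_set_8cycle/list_packing_on.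
move=> _ _ /packing_setP[c cL ->] /packing_setP[d dL ->] ne_cd.
rewrite disjoint_subset; apply/subsetP => e ec; rewrite inE.
by apply: contra ne_cd => ed; rewrite (edge_set_shared cL dL ec ed).
Qed.

(** The cycle [c] is arbitrary, so that the lemma applies to the edges of inside cycles too. *)
Lemma mem_cover_packing_set c p : cycle_on n.+1 c -> p \in cycle_edges c ->
  (pair_edge p \in cover (packing_set L)) = (p \in packing_edges L).
Proof.
move=> con pc; apply/bigcupP/flatten_mapP => [[_ /packing_setP[d dL ->]]|[d dL]].
  by rewrite (mem_edge_set _ con) ?list_packing_on //; exists d.
exists (edge_set d); first by apply/packing_setP; exists d.
by rewrite (mem_edge_set _ con) ?list_packing_on.
Qed.

Lemma edge_set_inj : {in L &, injective edge_set}.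
Proof.
move=> c d cL dL eq_cd; have : edge_set c != set0.
  by rewrite -cards_eq0 card_8cycle //; apply/edge_set_8cycle/list_packing_on.
case/set0Pn => e ec; apply: (edge_set_shared (e := e)) => //.
by rewrite -eq_cd.
Qed.

(** A repeated cycle would repeat its edges, and it has some. *)
Lemma list_packing_uniq : uniq L.
Proof.
case/andP: pL; elim: L => //= c s IHs /andP[con /IHs Us].
rewrite cat_uniq => /and3P[_ /hasPn dj /Us->]; rewrite andbT.
case/and3P: con => /eqP c8 _ _; apply/negP => cs.
have /(mem_nth (0, 0)) x_in : 0 < size (cycle_edges c) by rewrite size_cycle_edges c8.
by have := dj _ (introT flatten_mapP (ex_intro2 _ _ c cs x_in)); rewrite x_in.
Qed.

Lemma card_packing_set : #|packing_set L| = size L.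
Proof.
rewrite cardsE -(size_map edge_set); apply/card_uniqP.
by rewrite map_inj_in_uniq ?list_packing_uniq //; apply: edge_set_inj.
Qed.

Lemma list_packing_max : enough_cycles n.+1 (size L) ->
  max_packing8 (packing_set L).
Proof.
by rewrite -card_packing_set; apply: enough_cycles_max packing_set_packing8.
Qed.

Lemma list_packing_not_A2P p : p \in packing_edges L ->
  (forall c, c \in L -> p.1 \in c -> p.2 \in c -> p \in cycle_edges c) ->
  ~ A2P (packing_set L).
Proof.
move=> pE bad; have [c cL pc] := flatten_mapP pE.
have con := list_packing_on cL; have [lt_p le_p] := cycle_on_edge con pc.
apply: (@not_A2P_pair _ _ (inord p.1) (inord p.2)) => [|//|].
- exact: packing_set_packing8.
- by rewrite (mem_cover_packing_set con pc).
move=> _ /packing_setP[d dL ->]; have don := list_packing_on dL.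
rewrite cover_edge_set // => p1 p2.
rewrite inE /= inordK ?(leq_trans lt_p) ?leqW // in p1.
rewrite inE /= inordK // in p2.
by have := mem_edge_set don con pc; rewrite /pair_edge => ->; apply: bad.
Qed.

End ListPacking.
End Bridge.

(** * Exhaustive search for inside cycles *)

Fixpoint rel_arrangements (e : rel nat) k x (rest : seq nat) : seq (seq nat) :=
  if k is k'.+1 then
    flatten [seq [seq y :: r | r <- rel_arrangements e k' y (rem y rest)]
               | y <- rest & e x y]
  else [:: [::]].

(** The fuel is the number of vertices still to be placed. Completeness is what turns a failed
    search into a proof of nonexistence. *)
Lemma rel_arrangements_complete e x r rest : path e x r -> perm_eq r rest ->
  r \in rel_arrangements e (size rest) x rest.
Proof.
elim: r x rest => [|y r IHr] x rest /=.
  by move=> _ /perm_size/esym/size0nil ->.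
case/andP=> exy er r_rest; have y_rest : y \in rest by rewrite -(perm_mem r_rest) mem_head.
rewrite -(perm_size r_rest) /=; apply/flatten_mapP; exists y.
  by rewrite mem_filter exy.
apply: map_f; have r_rem : perm_eq r (rem y rest).
  by rewrite -(perm_cons y) (permPl r_rest) perm_to_rem.
by rewrite (perm_size r_rem); apply: IHr.
Qed.

(* The edge lists of the 8-cycles on the vertices of [c] whose edges belong to
   [A] and not to [c], each cycle being traversed from the head of [c]. *)
Definition inside_candidates (A : seq (nat * nat)) (c : seq nat) :=
  let c_edges := cycle_edges c in
  let ok p := if p \in A then p \notin c_edges else false in
  [seq s <- [seq cycle_edges (head 0 c :: r)
               | r <- rel_arrangements (fun x y => ok (norm_pair (x, y)))
                        (size c).-1 (head 0 c) (behead c)]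
     | all ok s].

(** Backtracking with pruning: a chosen edge list removes every later candidate that meets it.
    Running out of fuel answers [true], so that [false] is conclusive. The first components name the
    cycles for the completeness proof. *)
Fixpoint inside_search (k : nat)
    (cands : seq (seq nat * seq (seq (nat * nat)))) :=
  if k is k'.+1 then
    if cands is (_, ss) :: cands' then
      has (fun s => inside_search k'
        [seq (x.1, [seq r <- x.2 | ~~ has [in s] r]) | x <- cands']) ss
    else true
  else true.

(** The allowed edges [A] are separate from [L], so that the search can be run on some cycles of a
    packing while allowing all edges the packing covers. *)
Definition inside_choice (A : seq (nat * nat)) (L : seq (seq nat)) :=
  inside_search (size L) [seq (c, inside_candidates A c) | c <- L].

Lemma cycle_edges_path (P : pred (nat * nat)) h r :
  all P (cycle_edges (h :: r)) -> path (fun x y => P (norm_pair (x, y))) h r.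
Proof.
(* The closing vertex is generalised, as the induction moves the starting vertex but not the end. *)
rewrite /cycle_edges rot1_cons; move: (h in rcons _ h) => z.
by elim: r h => //= y r IHr h /andP[-> /IHr].
Qed.

Section Search.

Variables (n : nat) (L : seq (seq nat)).
Hypothesis pL : list_packing n.+1 L.
Let C := packing_set n L.

(** Following at each level the candidate contained in [f c] succeeds: since the sets [f c] are
    disjoint, the pruning never removes the candidate intended for a later cycle. *)
Lemma inside_search_complete (f : seq nat -> {set {set 'I_n.+1}}) k
    (cands : seq (seq nat * seq (seq (nat * nat)))) :
    uniq (unzip1 cands) ->
    (forall x, x \in cands -> exists2 r, r \in x.2 &
       forall p, p \in r -> pair_edge n p \in f x.1) ->
    {in unzip1 cands &, forall c d, c != d -> [disjoint f c & f d]} ->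
  inside_search k cands.
Proof.
elim: k cands => //= k IHk [|[c ss] cands] //= /andP[cs Us] fc djf.
have [r rc rf] := fc _ (mem_head _ _); apply/hasP; exists r => //.
set cands' := map _ _; have eq1 : unzip1 cands' = unzip1 cands.
  by rewrite /unzip1 -map_comp.
apply: IHk => [|_ /mapP[x x_in ->] /=|]; rewrite ?eq1 //; last first.
  by move=> d1 d2 in1 in2; apply: djf; rewrite inE ?in1 ?in2 orbT.
have [|q qx qf] := fc x; first by rewrite inE x_in orbT.
exists q => //; rewrite mem_filter qx andbT; apply/hasPn => p pq.
have x1_in : x.1 \in unzip1 cands by apply: map_f.
apply/negP => pr; have cx : c != x.1 by apply: contraNneq cs => ->.
have djx : [disjoint f c & f x.1] by apply: djf; rewrite // inE ?eqxx ?x1_in ?orbT.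
by have := disjointFr djx (rf _ pr); rewrite qf.
Qed.

Lemma inside_search_not_A2P s : {subset s <= L} -> uniq s ->
  ~~ inside_choice (packing_edges L) s -> ~ A2P C.
Proof.
move=> sL Us none [f [inf [djf lvf]]].
have pC : packing8 C := packing_set_packing8 pL.
case/negP: none.
have s1 A : unzip1 [seq (c, inside_candidates A c) | c <- s] = s.
  by rewrite /unzip1 -map_comp map_id.
apply: (@inside_search_complete (fun c => f (edge_set n c))); rewrite ?s1 //.
- move=> _ /mapP[c /sL cL ->] /=; have EC : edge_set n c \in C by apply/packing_setP; exists c.
  have con := list_packing_on pL cL; have [c8 Uc _] := and3P con.
  have [[t [Ut ft]] [eqV djE]] := inf _ EC.
  rewrite edge_set_tuple in ft.
  have ton : cycle_on n.+1 (map val t).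
    rewrite /cycle_on size_map size_tuple map_inj_uniq ?Ut /=; last exact: val_inj.
    by apply/allP => _ /mapP[x _ ->] /=.
  have tc : map val t =i c.
    move=> x; have [xn|xn] := ltnP x n.+1; last first.
      have out r : cycle_on n.+1 r -> (x \in r) = false.
        by case/and3P=> _ _ /allP rn; apply/negP => /rn; rewrite ltnNge xn.
      by rewrite !out.
    move/setP: eqV => /(_ (Ordinal xn)).
    by rewrite /cycle_vertices ft !cover_edge_set // !inE.
  case: c c8 Uc cL EC con djE tc eqV ft => // h c _ Uc cL EC con djE tc eqV ft.
  (* The inside cycle is rotated to start at the head of the original cycle, as the candidates
     do. *)
  have [|k r rot_t] := @rot_to _ (map val t) h; first by rewrite tc mem_head.
  have edges_t : cycle_edges (h :: r) =i cycle_edges (map val t).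
    by move=> p; rewrite -rot_t cycle_edges_rot mem_rot.
  have in_f p : p \in cycle_edges (h :: r) -> pair_edge n p \in f (edge_set n (h :: c)).
    by rewrite edges_t ft => pt; rewrite inE map_f.
  pose ok p := if p \in packing_edges L then p \notin cycle_edges (h :: c) else false.
  (* Its edges avoid the original cycle by disjointness, and are covered by the packing because
     packing and inside cycles cover the same edges. *)
  have r_ok : all ok (cycle_edges (h :: r)).
    apply/allP => p pr; rewrite /ok; have pt := pr; rewrite edges_t in pt.
    rewrite -(mem_cover_packing_set pL ton pt) -(mem_edge_set con ton pt).
    rewrite (disjointFl djE) ?in_f // (inside_cycles_cover _ pC inf djf lvf).
    case: bigcupP => // -[]; exists (f (edge_set n (h :: c))); rewrite ?in_f //.
    exact: imset_f.
  exists (cycle_edges (h :: r)) => //; rewrite mem_filter.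
  apply/andP; split; first exact: r_ok.
  apply: map_f; apply: rel_arrangements_complete.
    exact: (cycle_edges_path (P := ok)).
  rewrite -(perm_cons h) -rot_t perm_rot; apply: uniq_perm => //.
  by case/and3P: ton.
move=> c d /sL cL /sL dL cd; apply: djf.
- by apply/packing_setP; exists c.
- by apply/packing_setP; exists d.
by apply: contra cd => /eqP/(edge_set_inj pL cL dL)->.
Qed.

End Search.

(** * The cases of 10 and 11 vertices *)

Definition packing10 : seq (seq nat) :=
  [:: [:: 8; 5; 2; 6; 9; 3; 4; 7];
      [:: 4; 8; 1; 9; 5; 7; 2; 0];
      [:: 4; 9; 0; 7; 1; 5; 3; 6];
      [:: 7; 9; 2; 1; 6; 0; 8; 3];
      [:: 6; 5; 0; 3; 1; 4; 2; 8]].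

(* The first cycle has no inside 8-cycle avoiding the leave. *)
Definition packing11 : seq (seq nat) :=
  [:: [:: 2; 7; 10; 9; 0; 4; 1; 3];
      [:: 3; 9; 1; 8; 2; 4; 6; 10];
      [:: 3; 8; 5; 1; 7; 9; 2; 6];
      [:: 5; 9; 8; 7; 4; 10; 1; 6];
      [:: 3; 5; 2; 10; 0; 8; 6; 7];
      [:: 4; 9; 6; 0; 7; 5; 10; 8]].

(** Five cycles leave 45 - 40 = 5 edges, which is the lower bound [n / 2]. *)
Lemma exists_max_not_A2P_10 :
  exists C : {set {set {set 'I_10}}}, max_packing8 C /\ ~ A2P C.
Proof.
have pL : list_packing 10 packing10 by vm_compute.
exists (packing_set 9 packing10); split; first by apply: list_packing_max.
by apply: (inside_search_not_A2P pL (s := packing10)); [| | vm_compute].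
Qed.

(** Six cycles leave 55 - 48 = 7 edges, too few for one more cycle. *)
Lemma exists_max_not_A2P_11 :
  exists C : {set {set {set 'I_11}}}, max_packing8 C /\ ~ A2P C.
Proof.
have pL : list_packing 11 packing11 by vm_compute.
exists (packing_set 10 packing11); split; first by apply: list_packing_max.
apply: (inside_search_not_A2P pL (s := take 1 packing11)).
- by move=> c; apply: mem_take.
- by [].
- by vm_compute.
Qed.

(** * Relabelling of vertices and concatenation of edge lists *)

Definition shift k a b i := if i < k then a + i else b + (i - k).

Definition shift_cycles k a b (T : seq (seq nat)) :=
  [seq [seq shift k a b i | i <- c] | c <- T].

Lemma packing_edges_cat L1 L2 :
  packing_edges (L1 ++ L2) = packing_edges L1 ++ packing_edges L2.
Proof. by rewrite /packing_edges map_cat flatten_cat. Qed.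

Lemma packing_edges_flatten LL :
  packing_edges (flatten LL) = flatten (map packing_edges LL).
Proof. by elim: LL => //= L LL <-; rewrite packing_edges_cat. Qed.

Lemma size_flatten_const (I T : eqType) (F : I -> seq T) m s :
  (forall i, i \in s -> size (F i) = m) -> size (flatten (map F s)) = m * size s.
Proof.
elim: s => [|i s IHs] Fm /=; first by rewrite muln0.
rewrite size_cat Fm ?mem_head // IHs ?mulnS // => j js.
by rewrite Fm // inE js orbT.
Qed.

(** The blocks are disjoint because [tag] recovers the block of an element. Below, the tags are
    computed from the ends of an edge. *)
Lemma uniq_flatten_tag (I T : eqType) (F : I -> seq T) (tag : T -> I) s :
  uniq s -> (forall i, i \in s -> uniq (F i)) ->
  (forall i x, i \in s -> x \in F i -> tag x = i) -> uniq (flatten (map F s)).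
Proof.
elim: s => //= i s IHs /andP[i_s Us] UF tagF.
have s_in j : j \in s -> j \in i :: s by move=> js; rewrite inE js orbT.
rewrite cat_uniq UF ?mem_head //= IHs // => [|j /s_in/UF //|j x /s_in/tagF]; last exact.
rewrite andbT; apply/hasPn => x /flatten_mapP[j js xj].
apply: contra i_s => xi; suff -> : i = j by [].
by rewrite -(tagF i x) ?mem_head // (tagF j x) // s_in.
Qed.

Lemma shift_ltn k a b i j : a + k <= b -> i < j ->
  shift k a b i < shift k a b j.
Proof. by rewrite /shift; case: ifP; case: ifP; lia. Qed.

Lemma shift_inj k a b : a + k <= b -> injective (shift k a b).
Proof.
move=> akb i j ij; have := @shift_ltn k a b i j akb; have := @shift_ltn k a b j i akb.
by case: (ltngtP i j) => // _; rewrite ij ltnn => //; [move=> _|]; move/(_ isT).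
Qed.

Definition shift_pair k a b (p : nat * nat) := (shift k a b p.1, shift k a b p.2).

(** Under this bound [shift] is increasing, so it commutes with the minimum and maximum in
    [norm_pair]. *)
Lemma packing_edges_shift k a b T : a + k <= b ->
  packing_edges (shift_cycles k a b T) = map (shift_pair k a b) (packing_edges T).
Proof.
move=> akb; elim: T => //= c T; rewrite /packing_edges /= map_cat => ->.
congr (_ ++ _); rewrite /cycle_edges -map_rot.
elim: c (rot 1 c) => [|x c IHc] [|y r] //=; rewrite {}IHc; congr (_ :: _).
rewrite /norm_pair /shift_pair /minn /maxn /=.
case: (ltngtP x y) => [/(shift_ltn akb)->//|yx|->]; last by rewrite ltnn.
by have /ltnW := shift_ltn akb yx; rewrite leqNgt => /negbTE->.
Qed.

Lemma cycle_on_shift k a b m N c : a + k <= b ->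
  (forall i, i < m -> shift k a b i < N) ->
  cycle_on m c -> cycle_on N (map (shift k a b) c).
Proof.
move=> akb lt_mN /and3P[c8 Uc /allP cm]; apply/and3P; split.
- by rewrite size_map.
- by rewrite map_inj_uniq //; apply: shift_inj.
by apply/allP => _ /mapP[i /cm im ->]; apply: lt_mN.
Qed.

(* [bipartite_cycles k] decomposes K_(k,4), with parts [0, k) and [k, k + 4),
   for k = 4 and k = 6. *)
Definition bipartite_cycles k : seq (seq nat) :=
  if k == 4 then [:: [:: 0; 4; 1; 5; 2; 6; 3; 7]; [:: 0; 6; 1; 7; 2; 4; 3; 5]]
  else [:: [:: 0; 7; 2; 9; 3; 6; 4; 8]; [:: 4; 9; 5; 8; 2; 6; 1; 7];
           [:: 0; 9; 1; 8; 3; 7; 5; 6]].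

(** The last clause counts [k / 2] cycles for the [4 * k] edges of K_(k,4); with the other clauses
    it says that every edge is used. *)
Lemma bipartite_cyclesP k : k \in [:: 4; 6] ->
  [/\ all (cycle_on (k + 4)) (bipartite_cycles k),
      uniq (packing_edges (bipartite_cycles k)),
      all (fun p => p.1 < k <= p.2) (packing_edges (bipartite_cycles k)) &
      2 * size (bipartite_cycles k) = k].
Proof. by rewrite !inE => /orP[]/eqP->. Qed.

(** * The bipartite graph between old and new vertices *)

Definition block k a n j := shift_cycles k a (n + 4 * j) (bipartite_cycles k).

(** The [k] old vertices from [a] on are joined to the sixteen new ones, four at a time. *)
Definition block_row k a n := flatten [seq block k a n j | j <- iota 0 4].

Section BlockRow.

Variables k a n : nat.
Hypotheses (k46 : k \in [:: 4; 6]) (akn : a + k <= n).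

Lemma size_block_row : size (block_row k a n) = 2 * k.
Proof.
have [_ _ _ szk] := bipartite_cyclesP k46.
rewrite (size_flatten_const (m := size (bipartite_cycles k))).
  by rewrite size_iota; lia.
by move=> j _; rewrite size_map.
Qed.

Lemma block_row_on : all (cycle_on (n + 16)) (block_row k a n).
Proof.
have [/allP onk _ _ _] := bipartite_cyclesP k46.
apply/allP => _ /flatten_mapP[j j4 /mapP[c /onk con ->]].
rewrite mem_iota in j4.
apply: (cycle_on_shift _ _ con); first by lia.
by move=> i; rewrite /shift; case: ifP; lia.
Qed.

Lemma mem_block_row c x : c \in block_row k a n -> x \in c ->
  (a <= x < a + k) || (n <= x).
Proof.
case/flatten_mapP=> j _ /mapP[d _ ->] /mapP[i _ ->].
by rewrite /shift; case: ifP; lia.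
Qed.

Lemma block_edge j (p : nat * nat) : p \in packing_edges (block k a n j) ->
  (a <= p.1 < a + k) && (n + 4 * j <= p.2 < n + 4 * j + 4).
Proof.
have [/allP onk _ /allP bip _] := bipartite_cyclesP k46.
rewrite packing_edges_shift; last by lia.
case/mapP => q qE ->; have /andP[q1 q2] := bip _ qE.
rewrite /shift_pair /shift /= q1 [q.2 < k]ltnNge q2 /=.
have : q.2 < k + 4.
  case/flatten_mapP: qE => c /onk/and3P[_ _ /allP con] /cycle_edges_mem[_].
  exact: con.
by move: (q.1 : nat) (q.2 : nat) q1 q2 => x y; lia.
Qed.

Lemma block_row_edge (p : nat * nat) : p \in packing_edges (block_row k a n) ->
  (a <= p.1 < a + k) && (n <= p.2).
Proof.
rewrite packing_edges_flatten -map_comp => /flatten_mapP[j _ /block_edge].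
by case/and3P=> -> /=; lia.
Qed.

Lemma uniq_block_row : uniq (packing_edges (block_row k a n)).
Proof.
have [_ Uk _ _] := bipartite_cyclesP k46.
rewrite packing_edges_flatten -map_comp.
(* The new end of an edge tells its group of four, hence its block. *)
apply: (uniq_flatten_tag (tag := fun p => (p.2 - n) %/ 4)).
- exact: iota_uniq.
- move=> j _ /=; rewrite packing_edges_shift; last by lia.
  rewrite map_inj_uniq // => -[x y] [x' y'] []; have akb : a + k <= n + 4 * j by lia.
  by move=> /(shift_inj akb)-> /(shift_inj akb)->.
- by move=> j p _ /block_edge; case: p => x y /=; move: (x : nat) (y : nat); lia.
Qed.

End BlockRow.

(** The even number [n - odd n] of old vertices to be joined splits into groups of four, after one
    group of six if it is 2 modulo 4. *)
Definition has6 n := (n - odd n) %% 4 == 2.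

Definition row_start n := odd n + 6 * has6 n.

Definition row n i :=
  if i is i'.+1 then block_row 4 (row_start n + 4 * i') n
  else block_row 6 (odd n) n.

(** Index 0 is reserved for the group of six; without such a group the indices start at 1. *)
Definition rows n := iota (~~ has6 n) (has6 n + (n - row_start n) %/ 4).

Definition bipartite16 n := flatten [seq row n i | i <- rows n].

Section Bipartite16.

Variable n : nat.
Hypothesis n12 : 12 <= n.

(** Treats both group sizes uniformly. The last clause recovers the index of a group from any of its
    old vertices and serves as the tag separating the rows. *)
Lemma row_block i : i \in rows n ->
  exists k a, [/\ row n i = block_row k a n, k \in [:: 4; 6], a + k <= n,
    odd n <= a & (forall x, a <= x < a + k ->
      (if x < row_start n then 0 else ((x - row_start n) %/ 4).+1) = i)].
Proof.
rewrite mem_iota /row /row_start; case: i => [|i] /= in_i.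
  exists 6, (odd n); split=> //; first by lia.
  by move: in_i; case: has6 => //= _ x; case: ifP; lia.
exists 4, (odd n + 6 * has6 n + 4 * i); split=> //; first by lia.
- by lia.
by move=> x ax; case: ifP; lia.
Qed.

(** One eighth of the [16 * (n - odd n)] edges to be covered, so none is left over. *)
Lemma size_bipartite16 : size (bipartite16 n) = 2 * (n - odd n).
Proof.
have row4 s : 8 * s <= 2 * (n - row_start n) ->
    size (flatten [seq row n i | i <- iota 1 s]) = 8 * s.
  move=> s_le; rewrite (size_flatten_const (m := 8)) ?size_iota // => -[|i].
    by rewrite mem_iota.
  by rewrite mem_iota => i_lt; rewrite size_block_row //; lia.
have n4 : (n - odd n) %% 4 = 2 * has6 n by rewrite /has6; lia.
move: row4 n4; rewrite /bipartite16 /rows /row_start; case: has6 => row4 n4 /=.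
  by rewrite row4; lia.
by rewrite row4; lia.
Qed.

Lemma bipartite16_on : all (cycle_on (n + 16)) (bipartite16 n).
Proof.
apply/allP => c /flatten_mapP[i /row_block[k [a [-> k46 akn _ _]]]].
exact/allP/block_row_on.
Qed.

Lemma bipartite16_edge (p : nat * nat) : p \in packing_edges (bipartite16 n) ->
  (odd n <= p.1 < n) && (n <= p.2).
Proof.
rewrite packing_edges_flatten -map_comp => /flatten_mapP[i].
case/row_block=> k [a [/= -> k46 akn odd_a _]] /(block_row_edge k46 akn).
by lia.
Qed.

Lemma uniq_bipartite16 : uniq (packing_edges (bipartite16 n)).
Proof.
rewrite packing_edges_flatten -map_comp.
apply: (uniq_flatten_tag (tag := fun p =>
  if p.1 < row_start n then 0 else ((p.1 - row_start n) %/ 4).+1)).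
- exact: iota_uniq.
- by move=> i /row_block[k [a [/= -> k46 akn _ _]]]; apply: uniq_block_row.
move=> i p /row_block[k [a [/= -> k46 akn _ tagE]]] /(block_row_edge k46 akn).
by case/andP=> pa _; apply: tagE.
Qed.

(** The old vertices of such a cycle lie in an interval of at most six numbers, too short for both 0
    and 7. *)
Lemma bipartite16_apart c : c \in bipartite16 n -> ~~ ((0 \in c) && (7 \in c)).
Proof.
case/flatten_mapP=> i /row_block[k [a [-> k46 akn _ _]]] cR; apply/negP.
case/andP=> /(mem_block_row k46 akn cR) c0 /(mem_block_row k46 akn cR) c7.
by move: k46; rewrite !inE; lia.
Qed.

End Bipartite16.

(* Entry [i] packs K_(12 + i). In each packing the edge {0, 7} is covered, and
   no cycle has 0 and 7 as non-adjacent vertices. *)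
Definition base_packings : seq (seq (seq nat)) :=
  [:: [:: [:: 1; 2; 11; 9; 6; 5; 4; 8]; [:: 1; 5; 11; 6; 4; 2; 7; 3];
          [:: 4; 11; 0; 10; 6; 2; 3; 9]; [:: 8; 11; 3; 10; 5; 2; 9; 0];
          [:: 4; 10; 11; 1; 6; 8; 5; 3]; [:: 5; 9; 8; 2; 10; 1; 4; 7];
          [:: 9; 10; 8; 3; 6; 0; 7; 1]];
      [:: [:: 2; 6; 11; 0; 5; 4; 10; 3]; [:: 1; 6; 9; 11; 7; 4; 8; 3];
          [:: 4; 12; 7; 3; 9; 10; 11; 1]; [:: 10; 12; 11; 5; 7; 1; 9; 8];
          [:: 3; 6; 4; 11; 2; 7; 9; 5]; [:: 2; 8; 0; 12; 6; 10; 1; 5];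
          [:: 1; 8; 5; 6; 0; 9; 2; 12]; [:: 2; 4; 9; 12; 8; 6; 7; 10];
          [:: 3; 12; 5; 10; 0; 7; 8; 11]];
      [:: [:: 9; 12; 8; 1; 11; 4; 3; 2]; [:: 8; 13; 3; 12; 11; 2; 1; 9];
          [:: 5; 6; 1; 4; 9; 10; 13; 7]; [:: 0; 12; 1; 13; 9; 6; 3; 8];
          [:: 9; 3; 7; 12; 6; 13; 4; 5]; [:: 9; 0; 7; 4; 10; 8; 5; 11];
          [:: 7; 1; 5; 13; 11; 10; 12; 2]; [:: 12; 4; 8; 2; 6; 10; 3; 5];
          [:: 4; 2; 5; 10; 0; 11; 8; 6]; [:: 0; 6; 11; 3; 1; 10; 2; 13]];
      [:: [:: 5; 11; 4; 7; 13; 6; 2; 9]; [:: 0; 14; 13; 12; 10; 9; 6; 11];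
          [:: 3; 11; 12; 8; 7; 2; 4; 6]; [:: 5; 13; 4; 1; 8; 6; 12; 14];
          [:: 7; 11; 8; 2; 3; 12; 9; 1]; [:: 1; 11; 2; 10; 13; 9; 0; 6];
          [:: 4; 8; 10; 3; 7; 9; 11; 14]; [:: 1; 5; 12; 4; 9; 3; 8; 13];
          [:: 1; 12; 0; 5; 8; 9; 14; 10]; [:: 0; 7; 10; 11; 13; 3; 14; 8];
          [:: 7; 14; 6; 10; 4; 5; 2; 12]; [:: 2; 14; 1; 3; 5; 10; 0; 13]];
      [:: [:: 5; 14; 1; 9; 3; 11; 7; 12]; [:: 4; 14; 11; 8; 5; 7; 10; 2];
          [:: 3; 6; 14; 0; 15; 4; 10; 5]; [:: 10; 12; 14; 3; 0; 13; 9; 15];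
          [:: 9; 10; 13; 3; 15; 6; 4; 11]; [:: 0; 9; 5; 6; 10; 8; 13; 4];
          [:: 9; 14; 7; 3; 8; 2; 1; 12]; [:: 2; 11; 0; 12; 8; 1; 13; 15];
          [:: 9; 4; 12; 3; 10; 1; 7; 2]; [:: 9; 7; 0; 2; 12; 11; 1; 6];
          [:: 3; 4; 7; 13; 11; 5; 15; 1]; [:: 11; 15; 7; 8; 14; 2; 13; 6];
          [:: 14; 13; 5; 2; 6; 8; 0; 10]; [:: 6; 0; 5; 1; 4; 8; 15; 12]];
      [:: [:: 13; 15; 11; 14; 0; 4; 10; 16]; [:: 0; 15; 4; 2; 13; 12; 1; 10];
          [:: 10; 14; 3; 4; 1; 8; 2; 7]; [:: 1; 11; 4; 7; 15; 8; 12; 2];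
          [:: 5; 6; 9; 1; 0; 8; 13; 14]; [:: 0; 6; 11; 9; 2; 5; 4; 13];
          [:: 5; 7; 3; 13; 1; 6; 15; 9]; [:: 0; 7; 11; 8; 3; 6; 12; 16];
          [:: 1; 15; 2; 16; 6; 13; 9; 7]; [:: 4; 8; 5; 11; 16; 14; 15; 12];
          [:: 11; 12; 0; 5; 16; 9; 10; 2]; [:: 1; 3; 10; 8; 6; 4; 9; 14];
          [:: 3; 16; 7; 12; 5; 10; 6; 2]; [:: 12; 14; 7; 8; 9; 3; 11; 10];
          [:: 3; 5; 1; 16; 4; 14; 2; 0]; [:: 10; 13; 11; 0; 9; 12; 3; 15];
          [:: 5; 13; 7; 6; 14; 8; 16; 15]];
      [:: [:: 3; 12; 5; 17; 8; 1; 15; 9]; [:: 2; 6; 5; 11; 16; 4; 15; 10];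
          [:: 7; 14; 1; 13; 11; 6; 3; 4]; [:: 9; 12; 4; 2; 14; 5; 8; 7];
          [:: 8; 14; 10; 16; 6; 15; 7; 0]; [:: 0; 10; 4; 14; 17; 2; 15; 12];
          [:: 2; 8; 10; 6; 0; 9; 17; 11]; [:: 7; 13; 9; 16; 8; 15; 11; 1];
          [:: 3; 7; 10; 1; 2; 5; 15; 16]; [:: 4; 17; 3; 0; 16; 5; 13; 6];
          [:: 2; 16; 12; 6; 14; 9; 5; 0]; [:: 3; 15; 0; 14; 13; 4; 11; 8];
          [:: 1; 9; 6; 17; 12; 11; 7; 16]; [:: 16; 14; 12; 8; 4; 9; 10; 13];
          [:: 15; 13; 8; 6; 1; 12; 7; 17]; [:: 12; 2; 13; 17; 0; 11; 3; 10];
          [:: 14; 11; 9; 2; 7; 5; 1; 3]; [:: 13; 3; 5; 10; 17; 1; 4; 0]];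
      [:: [:: 11; 14; 7; 9; 15; 2; 18; 16]; [:: 5; 14; 6; 15; 12; 9; 0; 8];
          [:: 8; 12; 3; 6; 16; 15; 17; 7]; [:: 10; 18; 9; 3; 13; 15; 11; 1];
          [:: 3; 14; 9; 6; 18; 7; 12; 5]; [:: 9; 11; 18; 12; 0; 5; 1; 13];
          [:: 2; 7; 0; 15; 18; 1; 8; 16]; [:: 2; 8; 14; 1; 7; 5; 16; 4];
          [:: 0; 4; 1; 12; 11; 2; 6; 13]; [:: 2; 12; 17; 0; 6; 1; 15; 14];
          [:: 5; 6; 11; 8; 3; 10; 17; 18]; [:: 11; 13; 12; 6; 17; 8; 18; 3];
          [:: 3; 7; 13; 14; 10; 9; 8; 15]; [:: 4; 10; 0; 1; 16; 3; 17; 11];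
          [:: 6; 8; 4; 14; 16; 17; 13; 10]; [:: 4; 15; 5; 10; 11; 0; 2; 17];
          [:: 2; 10; 12; 4; 3; 0; 18; 13]; [:: 0; 14; 17; 9; 5; 4; 13; 16];
          [:: 17; 1; 9; 4; 6; 7; 11; 5]; [:: 9; 2; 5; 13; 8; 10; 7; 16];
          [:: 7; 15; 10; 16; 12; 14; 18; 4]];
      [:: [:: 6; 9; 19; 2; 15; 10; 1; 14]; [:: 3; 11; 2; 10; 5; 13; 7; 4];
          [:: 10; 14; 4; 15; 11; 0; 12; 8]; [:: 8; 9; 14; 18; 6; 5; 19; 17];
          [:: 1; 9; 16; 14; 2; 6; 13; 4]; [:: 16; 19; 7; 2; 12; 5; 17; 10];
          [:: 13; 17; 7; 1; 15; 8; 6; 3]; [:: 3; 7; 18; 10; 19; 11; 4; 16];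
          [:: 15; 17; 2; 5; 11; 6; 10; 12]; [:: 0; 8; 11; 1; 2; 18; 9; 13];
          [:: 2; 16; 11; 13; 10; 0; 15; 9]; [:: 12; 18; 5; 15; 16; 1; 8; 4];
          [:: 13; 18; 11; 17; 12; 19; 14; 8]; [:: 5; 7; 16; 13; 15; 18; 1; 3];
          [:: 3; 8; 5; 16; 0; 7; 12; 14]; [:: 8; 18; 3; 19; 0; 14; 13; 2];
          [:: 1; 13; 19; 8; 16; 18; 0; 17]; [:: 0; 9; 4; 17; 3; 15; 19; 6];
          [:: 19; 1; 12; 9; 17; 14; 5; 4]; [:: 18; 17; 6; 1; 5; 9; 10; 4];
          [:: 2; 4; 6; 16; 12; 11; 10; 3]; [:: 12; 3; 9; 11; 14; 7; 15; 6]];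
      [:: [:: 10; 16; 13; 7; 20; 5; 15; 6]; [:: 8; 9; 11; 1; 14; 7; 17; 4];
          [:: 2; 11; 3; 14; 6; 18; 1; 4]; [:: 3; 10; 12; 14; 2; 16; 5; 1];
          [:: 9; 10; 1; 17; 13; 6; 11; 15]; [:: 8; 18; 19; 7; 10; 5; 2; 17];
          [:: 8; 19; 16; 1; 20; 15; 7; 12]; [:: 6; 9; 7; 0; 12; 11; 16; 20];
          [:: 4; 6; 16; 12; 1; 19; 14; 11]; [:: 15; 19; 5; 0; 11; 13; 12; 17];
          [:: 0; 10; 11; 17; 18; 12; 15; 16]; [:: 4; 13; 1; 8; 3; 15; 18; 9];
          [:: 3; 20; 14; 15; 13; 18; 0; 19]; [:: 2; 6; 7; 1; 15; 4; 10; 20];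
          [:: 4; 12; 3; 13; 5; 18; 2; 7]; [:: 11; 18; 16; 14; 8; 15; 2; 19];
          [:: 6; 12; 9; 16; 7; 18; 10; 17]; [:: 2; 12; 5; 8; 13; 14; 18; 3];
          [:: 9; 20; 11; 7; 3; 5; 14; 17]; [:: 17; 20; 18; 4; 14; 10; 13; 0];
          [:: 6; 19; 12; 20; 13; 2; 9; 1]; [:: 4; 16; 8; 0; 14; 9; 13; 19];
          [:: 2; 10; 15; 0; 9; 5; 11; 8]; [:: 6; 0; 20; 8; 10; 19; 17; 3];
          [:: 5; 17; 16; 3; 9; 19; 20; 4]];
      [:: [:: 13; 19; 6; 15; 7; 1; 21; 5]; [:: 8; 10; 4; 14; 21; 13; 9; 2];
          [:: 10; 15; 20; 18; 0; 11; 9; 3]; [:: 0; 9; 19; 8; 1; 16; 14; 13];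
          [:: 5; 17; 6; 0; 7; 19; 20; 8]; [:: 7; 17; 3; 18; 9; 16; 6; 14];
          [:: 8; 13; 6; 21; 3; 20; 17; 0]; [:: 15; 16; 0; 21; 10; 2; 1; 12];
          [:: 13; 18; 17; 9; 10; 6; 3; 1]; [:: 14; 20; 6; 12; 9; 1; 19; 2];
          [:: 5; 16; 10; 19; 15; 1; 14; 9]; [:: 2; 17; 8; 11; 20; 1; 4; 12];
          [:: 9; 21; 11; 10; 20; 2; 4; 6]; [:: 5; 20; 16; 19; 11; 3; 2; 15];
          [:: 2; 11; 6; 1; 5; 4; 15; 13]; [:: 3; 8; 4; 20; 7; 16; 18; 12];
          [:: 13; 16; 4; 17; 10; 14; 5; 3]; [:: 4; 18; 21; 19; 5; 10; 1; 11];
          [:: 2; 5; 7; 21; 4; 3; 14; 18]; [:: 8; 12; 17; 21; 16; 11; 5; 6];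
          [:: 11; 12; 7; 13; 20; 9; 8; 18]; [:: 15; 21; 2; 16; 8; 14; 19; 0];
          [:: 5; 18; 7; 3; 19; 17; 14; 12]; [:: 7; 2; 6; 18; 10; 12; 19; 4];
          [:: 10; 13; 17; 15; 8; 21; 12; 0]; [:: 12; 16; 3; 15; 11; 14; 0; 20];
          [:: 15; 18; 1; 17; 11; 13; 4; 9]];
      [:: [:: 2; 9; 21; 14; 4; 1; 22; 15]; [:: 9; 11; 15; 18; 7; 1; 21; 22];
          [:: 12; 18; 11; 20; 19; 4; 7; 10]; [:: 3; 19; 2; 6; 5; 12; 15; 20];
          [:: 0; 22; 17; 21; 11; 10; 9; 16]; [:: 3; 13; 17; 1; 12; 21; 7; 9];
          [:: 12; 19; 10; 4; 21; 15; 9; 0]; [:: 4; 6; 17; 7; 15; 19; 14; 18];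
          [:: 9; 17; 2; 20; 7; 5; 21; 19]; [:: 13; 18; 9; 20; 8; 21; 0; 1];
          [:: 6; 18; 21; 2; 22; 11; 5; 0]; [:: 1; 14; 12; 4; 11; 2; 5; 16];
          [:: 14; 16; 10; 8; 19; 6; 13; 22]; [:: 18; 19; 11; 6; 20; 22; 5; 3];
          [:: 16; 20; 0; 2; 14; 5; 8; 12]; [:: 16; 17; 5; 20; 12; 6; 3; 8];
          [:: 3; 12; 2; 18; 17; 15; 13; 10]; [:: 17; 20; 21; 3; 7; 19; 22; 10];
          [:: 1; 11; 8; 2; 4; 9; 13; 19]; [:: 8; 22; 18; 10; 5; 19; 0; 15];
          [:: 0; 3; 22; 16; 2; 10; 14; 11]; [:: 8; 17; 12; 11; 16; 21; 6; 1];
          [:: 6; 10; 15; 1; 18; 0; 4; 16]; [:: 4; 13; 14; 0; 7; 6; 9; 8];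
          [:: 3; 11; 13; 20; 18; 16; 19; 17]; [:: 18; 5; 15; 6; 14; 17; 0; 8];
          [:: 0; 10; 1; 20; 4; 22; 12; 13]; [:: 6; 22; 7; 12; 9; 5; 13; 8];
          [:: 8; 14; 20; 10; 21; 13; 2; 7]; [:: 17; 4; 15; 14; 3; 16; 7; 11];
          [:: 9; 14; 7; 13; 16; 15; 3; 1]];
      [:: [:: 2; 21; 13; 7; 9; 22; 15; 16]; [:: 8; 12; 23; 2; 22; 10; 18; 3];
          [:: 1; 5; 17; 9; 3; 19; 13; 20]; [:: 0; 21; 10; 2; 6; 5; 12; 22];
          [:: 18; 20; 0; 14; 19; 9; 13; 5]; [:: 3; 7; 20; 17; 21; 14; 16; 10];
          [:: 4; 11; 13; 17; 8; 14; 18; 16]; [:: 6; 18; 0; 19; 22; 16; 13; 14];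
          [:: 4; 6; 10; 15; 11; 23; 9; 14]; [:: 11; 20; 8; 7; 16; 1; 4; 3];
          [:: 1; 23; 21; 5; 8; 13; 15; 19]; [:: 2; 5; 0; 23; 10; 13; 4; 8];
          [:: 1; 14; 22; 11; 16; 9; 10; 8]; [:: 4; 19; 21; 16; 5; 10; 14; 23];
          [:: 6; 22; 4; 18; 7; 17; 2; 13]; [:: 6; 17; 18; 2; 19; 10; 4; 15];
          [:: 4; 20; 6; 11; 5; 14; 2; 7]; [:: 7; 22; 5; 23; 16; 12; 14; 11];
          [:: 3; 15; 9; 4; 21; 12; 19; 6]; [:: 7; 21; 1; 15; 2; 9; 5; 19];
          [:: 1; 22; 3; 0; 11; 21; 15; 12]; [:: 15; 23; 6; 1; 7; 10; 12; 18];
          [:: 11; 17; 4; 12; 20; 23; 8; 19]; [:: 5; 20; 16; 19; 17; 12; 0; 15];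
          [:: 7; 23; 3; 12; 9; 6; 8; 15]; [:: 1; 9; 21; 6; 12; 2; 20; 3];
          [:: 18; 23; 13; 0; 4; 2; 11; 9]; [:: 14; 17; 22; 8; 11; 1; 10; 20];
          [:: 5; 7; 12; 11; 18; 22; 13; 3]; [:: 7; 14; 3; 21; 18; 1; 17; 0];
          [:: 2; 1; 13; 18; 8; 16; 6; 0]; [:: 21; 8; 0; 10; 17; 15; 20; 22];
          [:: 9; 0; 16; 3; 17; 23; 19; 20]];
      [:: [:: 2; 6; 12; 22; 9; 24; 18; 10]; [:: 5; 7; 0; 10; 4; 19; 3; 23];
          [:: 7; 14; 13; 3; 12; 16; 19; 15]; [:: 2; 13; 17; 16; 9; 10; 11; 4];
          [:: 10; 20; 21; 22; 24; 3; 9; 8]; [:: 3; 10; 15; 17; 7; 2; 19; 1];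
          [:: 12; 21; 8; 2; 15; 18; 14; 23]; [:: 2; 24; 4; 14; 22; 3; 5; 18];
          [:: 3; 11; 2; 17; 9; 15; 12; 0]; [:: 19; 20; 12; 13; 16; 6; 21; 10];
          [:: 0; 22; 15; 5; 11; 6; 20; 9]; [:: 5; 9; 21; 24; 12; 19; 6; 14];
          [:: 6; 10; 7; 22; 19; 13; 24; 1]; [:: 11; 20; 4; 22; 8; 14; 21; 7];
          [:: 11; 16; 22; 1; 15; 0; 21; 18]; [:: 3; 17; 18; 23; 6; 9; 19; 8];
          [:: 1; 18; 20; 15; 21; 23; 13; 7]; [:: 8; 20; 23; 16; 18; 19; 11; 15];
          [:: 8; 23; 19; 14; 15; 13; 21; 1]; [:: 15; 16; 2; 0; 1; 10; 24; 6];
          [:: 8; 12; 9; 18; 13; 5; 6; 4]; [:: 3; 6; 13; 8; 5; 2; 14; 16];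
          [:: 2; 22; 11; 0; 5; 16; 4; 23]; [:: 22; 23; 15; 3; 7; 18; 12; 17];
          [:: 2; 21; 3; 14; 0; 17; 4; 9]; [:: 8; 11; 23; 9; 1; 16; 0; 6];
          [:: 4; 7; 20; 1; 5; 17; 14; 12]; [:: 3; 18; 22; 13; 4; 0; 24; 20];
          [:: 11; 13; 9; 7; 19; 17; 23; 1]; [:: 8; 16; 10; 12; 1; 14; 11; 24];
          [:: 7; 16; 24; 19; 5; 10; 17; 8]; [:: 6; 17; 1; 13; 20; 0; 8; 18];
          [:: 6; 22; 20; 5; 4; 15; 24; 7]; [:: 9; 11; 21; 19; 0; 13; 10; 14];
          [:: 4; 18; 0; 23; 10; 22; 5; 21]; [:: 2; 20; 16; 21; 17; 24; 5; 12];
          [:: 17; 11; 12; 7; 23; 24; 14; 20]];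
      [:: [:: 19; 22; 16; 23; 11; 24; 7; 3]; [:: 13; 17; 15; 19; 16; 14; 3; 10];
          [:: 5; 19; 20; 25; 0; 10; 14; 13]; [:: 14; 25; 4; 1; 20; 23; 21; 12];
          [:: 5; 12; 16; 11; 19; 21; 10; 8]; [:: 1; 19; 4; 17; 0; 21; 5; 14];
          [:: 4; 14; 6; 13; 24; 10; 15; 22]; [:: 9; 14; 18; 20; 5; 23; 8; 24];
          [:: 4; 9; 15; 16; 5; 24; 0; 8]; [:: 4; 23; 1; 2; 13; 19; 6; 11];
          [:: 11; 18; 21; 7; 2; 8; 3; 1]; [:: 6; 21; 4; 13; 8; 12; 18; 24];
          [:: 11; 21; 22; 10; 5; 9; 17; 20]; [:: 16; 25; 15; 21; 24; 12; 9; 7];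
          [:: 14; 19; 8; 21; 16; 4; 10; 23]; [:: 8; 18; 4; 12; 3; 22; 25; 6];
          [:: 11; 14; 21; 2; 24; 16; 20; 7]; [:: 6; 18; 13; 23; 19; 7; 1; 16];
          [:: 14; 22; 2; 0; 13; 9; 3; 20]; [:: 4; 7; 15; 18; 10; 2; 17; 24];
          [:: 9; 23; 7; 5; 17; 18; 3; 21]; [:: 6; 20; 22; 8; 16; 0; 15; 5];
          [:: 1; 10; 9; 2; 15; 20; 0; 5]; [:: 2; 4; 20; 8; 25; 13; 7; 14];
          [:: 16; 18; 22; 1; 12; 2; 20; 9]; [:: 1; 24; 3; 25; 2; 23; 0; 9];
          [:: 15; 23; 6; 2; 18; 5; 25; 11]; [:: 3; 15; 1; 8; 14; 24; 19; 0];
          [:: 1; 6; 9; 22; 13; 20; 10; 25]; [:: 3; 23; 18; 25; 19; 2; 5; 11];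
          [:: 10; 17; 1; 13; 3; 5; 22; 12]; [:: 0; 4; 15; 13; 21; 25; 17; 12];
          [:: 0; 18; 9; 19; 12; 20; 24; 22]; [:: 4; 6; 10; 7; 0; 14; 17; 3];
          [:: 0; 6; 22; 17; 23; 25; 12; 11]; [:: 18; 1; 21; 17; 11; 9; 25; 7];
          [:: 22; 11; 2; 16; 10; 19; 17; 7]; [:: 24; 23; 12; 7; 8; 17; 6; 15];
          [:: 15; 12; 6; 3; 16; 13; 11; 8]];
      [:: [:: 8; 14; 23; 26; 7; 11; 15; 19]; [:: 5; 7; 25; 2; 18; 26; 16; 11];
          [:: 11; 18; 25; 6; 13; 3; 22; 21]; [:: 15; 16; 14; 1; 8; 18; 21; 26];
          [:: 16; 22; 19; 9; 10; 4; 2; 5]; [:: 1; 21; 13; 23; 24; 7; 10; 16];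
          [:: 21; 25; 17; 20; 1; 5; 15; 14]; [:: 3; 25; 12; 0; 15; 22; 9; 24];
          [:: 10; 21; 19; 4; 17; 24; 6; 15]; [:: 2; 13; 4; 16; 23; 20; 15; 8];
          [:: 6; 22; 11; 26; 10; 12; 21; 3]; [:: 1; 18; 7; 9; 26; 14; 3; 19];
          [:: 9; 13; 25; 5; 18; 19; 23; 2]; [:: 13; 14; 25; 8; 22; 0; 5; 17];
          [:: 9; 12; 20; 2; 14; 19; 25; 0]; [:: 11; 24; 21; 0; 8; 9; 17; 6];
          [:: 10; 20; 22; 24; 26; 25; 1; 11]; [:: 1; 17; 2; 0; 16; 6; 26; 22];
          [:: 11; 17; 7; 13; 12; 2; 24; 19]; [:: 10; 25; 16; 18; 3; 12; 22; 23];
          [:: 1; 26; 2; 10; 24; 13; 20; 9]; [:: 16; 17; 12; 18; 20; 24; 1; 7];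
          [:: 17; 18; 23; 7; 12; 1; 15; 3]; [:: 14; 22; 5; 12; 24; 0; 19; 17];
          [:: 9; 18; 13; 10; 5; 26; 8; 11]; [:: 3; 23; 8; 5; 9; 21; 15; 7];
          [:: 0; 1; 13; 11; 4; 15; 2; 7]; [:: 4; 12; 26; 3; 8; 13; 16; 21];
          [:: 0; 13; 15; 23; 25; 24; 8; 20]; [:: 3; 10; 18; 24; 16; 9; 14; 11];
          [:: 7; 20; 21; 8; 12; 11; 25; 4]; [:: 3; 5; 21; 17; 0; 23; 1; 4];
          [:: 6; 9; 4; 20; 5; 13; 26; 0]; [:: 20; 25; 15; 24; 4; 22; 7; 14];
          [:: 13; 19; 5; 24; 14; 10; 17; 22]; [:: 4; 23; 9; 3; 16; 20; 19; 26];
          [:: 2; 16; 8; 7; 19; 6; 23; 11]; [:: 12; 23; 5; 14; 4; 6; 2; 19];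
          [:: 26; 17; 15; 18; 14; 0; 11; 20]; [:: 16; 19; 10; 0; 18; 6; 14; 12];
          [:: 8; 17; 23; 21; 7; 6; 1; 10]; [:: 21; 2; 22; 25; 9; 15; 12; 6];
          [:: 4; 18; 22; 10; 6; 20; 3; 0]]].

(** * Packings in which 0 and 7 meet only along their edge *)

Definition base_packing n := nth [::] base_packings (n - 12).

(** The invariant of the induction, boolean so that the base cases are settled by computation. *)
Definition good_packing n L :=
  [&& list_packing n L, enough_cycles n (size L), (0, 7) \in packing_edges L &
      all (fun c => (0 \in c) && (7 \in c) ==> ((0, 7) \in cycle_edges c)) L].

Lemma good_packing_not_A2P n L : good_packing n.+1 L ->
  exists C : {set {set {set 'I_n.+1}}}, max_packing8 C /\ ~ A2P C.
Proof.
case/and4P=> pL kL L07 /allP apart; exists (packing_set n L).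
split; first exact: list_packing_max.
apply: (list_packing_not_A2P pL L07) => c /apart /=.
by move=> /implyP h c0 c7; apply: h; rewrite c0.
Qed.

Lemma good_base_packing n : 12 <= n < 28 -> good_packing n (base_packing n).
Proof.
move=> n_range; have : n \in iota 12 16 by rewrite mem_iota; lia.
apply: (allP (a := fun n => good_packing n (base_packing n))).
by vm_compute.
Qed.

(* For odd n, the 16 new vertices and the old vertex 0 span a copy of K_17,
   which is decomposed. For even n, the new vertices span K_16. *)
Definition inner16 n := shift_cycles (odd n) 0 n (base_packing (16 + odd n)).

Definition extend16 n L := (L ++ inner16 n) ++ bipartite16 n.

(** * Adding sixteen vertices *)

Section Extend16.

Variable n : nat.
Hypothesis n12 : 12 <= n.

Lemma good_inner_base : good_packing (16 + odd n) (base_packing (16 + odd n)).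
Proof. by apply: good_base_packing; lia. Qed.

Lemma inner16_on : all (cycle_on (n + 16)) (inner16 n).
Proof.
have /and4P[/andP[/allP onB _] _ _ _] := good_inner_base.
apply/allP => _ /mapP[c /onB con ->]; apply: (cycle_on_shift _ _ con).
  by lia.
by move=> i; rewrite /shift; case: ifP; lia.
Qed.

Lemma uniq_inner16 : uniq (packing_edges (inner16 n)).
Proof.
have /and4P[/andP[_ UB] _ _ _] := good_inner_base.
have on : 0 + odd n <= n by lia.
rewrite packing_edges_shift // map_inj_uniq // => -[x y] [x' y'] [].
by move=> /(shift_inj on)-> /(shift_inj on)->.
Qed.

Lemma mem_inner16 c x : c \in inner16 n -> x \in c -> (x < odd n) || (n <= x).
Proof.
by case/mapP=> d _ -> /mapP[i _ ->]; rewrite /shift; case: ifP; lia.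
Qed.

(** The only old vertex an inner cycle can have is 0, so the larger end of an edge is new. *)
Lemma inner16_edge (p : nat * nat) : p \in packing_edges (inner16 n) ->
  ((p.1 < odd n) || (n <= p.1)) && (n <= p.2).
Proof.
case/flatten_mapP=> c cI pc; have [p1 p2] := cycle_edges_mem pc.
have := mem_inner16 cI p1; have := mem_inner16 cI p2.
have /and3P[/eqP c8 Uc _] := allP inner16_on _ cI.
have : p.1 < p.2 by apply: cycle_edges_lt pc; rewrite ?c8.
by move: (p.1 : nat) (p.2 : nat) => x y; case: odd; lia.
Qed.

(** The ends separate the three families: edges of [L] have an old larger end, the others a new one.
    The smaller end is new or the shared vertex 0 for inner edges, and an old vertex to be joined
    for bipartite edges. *)
Lemma list_packing_extend16 L : list_packing n L ->
  list_packing (n + 16) (extend16 n L).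
Proof.
case/andP=> onL UL; rewrite /list_packing /extend16 !all_cat inner16_on bipartite16_on //.
rewrite !packing_edges_cat !cat_uniq UL uniq_inner16 uniq_bipartite16 // !andbT /=.
have old (p : nat * nat) : p \in packing_edges L -> p.2 < n.
  case/flatten_mapP=> c cL /cycle_edges_mem[_ p2].
  by have /and3P[_ _ /allP] := allP onL _ cL; apply.
apply/and3P; split.
- apply: sub_all onL => c /and3P[c8 Uc con]; rewrite /cycle_on c8 Uc.
  by apply: sub_all con => x; lia.
- by apply/hasPn => p /inner16_edge/andP[_ n_p]; apply: contraL n_p => /old; rewrite -ltnNge.
apply/hasPn => p /bipartite16_edge - /(_ n12); rewrite mem_cat negb_or.
case/andP=> p1 p2; apply/andP; split.
  by apply: contraL p2 => /old; rewrite -ltnNge.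
by apply/negP => /inner16_edge; move: (p.1 : nat) (p.2 : nat) p1 p2; lia.
Qed.

(** There are [16 * n + 120] more edges. For odd [n], the [17 + 2 * (n - 1)] new cycles use them
    all; for even [n], the [14 + 2 * n] new cycles leave 8, exactly the growth of [n / 2]. *)
Lemma enough_cycles_extend16 L : enough_cycles n (size L) ->
  enough_cycles (n + 16) (size (extend16 n L)).
Proof.
have szI : size (inner16 n) = 14 + 3 * odd n by rewrite size_map; case: odd.
rewrite /extend16 !size_cat szI size_bipartite16 // /enough_cycles oddD addbF.
have -> : 'C(n + 16, 2) = 'C(n, 2) + 16 * n + 120.
  rewrite !bin2; case: (n) n12 => //= m _; lia.
by case: odd; lia.
Qed.

Lemma good_extend16 L : good_packing n L -> good_packing (n + 16) (extend16 n L).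
Proof.
case/and4P=> pL kL L07 apart; apply/and4P; split.
- exact: list_packing_extend16.
- exact: enough_cycles_extend16.
- by rewrite !packing_edges_cat !mem_cat L07.
rewrite !all_cat apart /=; apply/andP; split; apply/allP => c cI; last first.
  by apply/implyP; rewrite (negbTE (bipartite16_apart n12 cI)).
(* Inner cycles avoid 7, an old vertex other than 0. *)
by apply/implyP => /andP[_ /(mem_inner16 cI)]; lia.
Qed.

End Extend16.

(** * Induction in steps of sixteen, and the theorem *)

Lemma exists_good_packing n : 12 <= n -> exists L, good_packing n L.
Proof.
elim/ltn_ind: n => n IHn n12; have [n28|n28] := ltnP n 28.
  by exists (base_packing n); apply: good_base_packing; rewrite n12.
have [||L gL] := IHn (n - 16); try by lia.
exists (extend16 (n - 16) L); rewrite -[n](subnK (n := n) (m := 16)); last by lia.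
by rewrite addnK; apply: good_extend16 => //; lia.
Qed.

Theorem mainTheorem2 (n : nat) (hn : 10 <= n) :
  exists C : {set {set {set 'I_n}}}, max_packing8 C /\ ~ A2P C.
Proof.
have [n12|n12] := leqP 12 n.
  have [L gL] := exists_good_packing n12.
  by case: n {hn} n12 gL => // n _; apply: good_packing_not_A2P.
have [->|->] : n = 10 \/ n = 11 by lia.
  exact: exists_max_not_A2P_10.
exact: exists_max_not_A2P_11.
Qed.
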